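(* Let $n$ be a positive integer. Then both \[ \frac{1}{n}\sum_{k=0}^{n-1}(2k+1)\,\mathrm{Domb}(k)\,8^{n-1-k} \quad\text{and}\quad \frac{1}{n}\sum_{k=0}^{n-1}(2k+1)\,\mathrm{Domb}(k)\,(-8)^{n-1-k} \] are positive integers.
   Context: The Domb numbers are $\mathrm{Domb}(n)=\sum_{k=0}^n\binom{n}{k}^2\binom{2k}{k}\binom{2n-2k}{n-k}$. *)

(* Defs.v *)
From mathcomp Require Import all_boot.

Definition Domb (n : nat) : nat :=
  \sum_(0 <= k < n.+1) 'C(n, k) ^ 2 * 'C(2 * k, k) * 'C(2 * n - 2 * k, n - k).

(* Main.v *)
Require Import Defs.
From mathcomp Require Import all_boot all_order all_algebra.
From mathcomp Require Import ring lra zify.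

Import Order.TTheory GRing.Theory Num.Theory.
Local Open Scope ring_scope.

(** With the Franel numbers f_j = sum_i C(j,i)^3 one has
      Domb(n) = sum_j C(n,j) C(n+j,j) (-1)^j f_j 8^(n-j),
    because both sides satisfy
      (n+1)^3 u_(n+1) = 2 (2n+1) (5n^2+5n+2) u_n - 64 n^3 u_(n-1).
    Substituting this in the two sums and exchanging the summations leaves
      sum_(k<n) (2k+1) C(k,j) C(k+j,j) = n C(n,j+1) C(n+j,j),
      sum_(k<n) (-1)^(n-1-k) (2k+1) C(k,j) C(k+j,j) = n C(n-1,j) C(n+j,j),
    so that n divides both sums.  Since (2k+1) Domb(k) grows by a factor of
    more than 8 at each step, the alternating sum has the sign of its last
    term. *)

(** * Creative telescoping for self-convolutions *)

Definition self_conv (w : nat -> rat) (n : nat) : rat :=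
  \sum_(0 <= k < n.+1) w k * w (n - k)%N.

(* Shifting [w] by two zero entries lets the terms of the three convolutions
   below share one summation range, without boundary cases. *)
Definition pad2 (w : nat -> rat) (m : nat) : rat := if m is m'.+2 then w m' else 0.

Lemma self_conv_pad2 (w : nat -> rat) (n d N : nat) : (N + d = n.+2)%N -> (d <= 2)%N ->
  self_conv w N = \sum_(0 <= k < n.+3) w k * pad2 w (n.+4 - d - k)%N.
Proof.
move=> e d2; rewrite /self_conv [RHS](big_cat_nat (n := N.+1)) /=; [|by []|lia].
rewrite [X in _ + X]big_nat_cond [X in _ + X]big1 ?addr0; last first.
  move=> k /andP[/andP[kN kn] _]; have : (n.+4 - d - k < 2)%N by lia.
  by case: (n.+4 - d - k)%N => [|[]] //=; rewrite mulr0.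
apply: eq_big_nat => k /andP[_ kN].
by have -> : (n.+4 - d - k = (N - k).+2)%N by lia.
Qed.

(** With [m = n + 2 - k], the padded summands of the three convolutions combine to [G k.+1 - G k],
    so the sum collapses to boundary values of [G], both zero. *)
Lemma self_conv_rec (w G : nat -> rat) (n : nat) (a b c : rat) :
  (forall k m, (k + m = n.+2)%N -> w k * (a * pad2 w m.+2 + b * pad2 w m.+1 + c * pad2 w m)
     = G k.+1 - G k) -> G 0%N = 0 -> G n.+3 = 0 ->
  a * self_conv w n.+2 + b * self_conv w n.+1 + c * self_conv w n = 0.
Proof.
move=> H G0 G1.
rewrite (@self_conv_pad2 w n 0 n.+2) ?addn0 // (@self_conv_pad2 w n 1 n.+1) ?addn1 //.
rewrite (@self_conv_pad2 w n 2 n) ?addn2 // !mulr_sumr -!big_split /=.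
rewrite (@eq_big_nat _ _ _ _ _ _ (fun k => G k.+1 - G k)).
  by rewrite telescope_sumr // G0 G1 subrr.
move=> k /andP[_ kn]; have [m e] : exists m, (k + m = n.+2)%N by exists (n.+2 - k)%N; lia.
rewrite -(H k m e).
have -> : (n.+4 - 0 - k = m.+2)%N by lia.
have -> : (n.+4 - 1 - k = m.+1)%N by lia.
have -> : (n.+4 - 2 - k = m)%N by lia.
ring.
Qed.

(** Parity keeps the denominators [2m - 1] and [2m - 3] of the Domb telescoping function nonzero. *)
Lemma double_sub_odd_neq0 (m c : nat) : odd c -> 2 * m%:R - c%:R != 0 :> rat.
Proof.
by move=> oc; rewrite subr_eq0 -natrM eqr_nat; apply/eqP=> e;
   move: oc; rewrite -e mul2n odd_double.
Qed.

(** * Domb and Franel numbers as convolutions, and their recurrences *)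

Definition franel (n : nat) : nat := \sum_(0 <= k < n.+1) 'C(n, k) ^ 3.

(** Divided by [n!^2], the Domb summand factors as [domb_w k * domb_w (n - k)]; [franel_w] does the
    same for the Franel summand and [n!^3]. *)
Definition domb_w (k : nat) : rat := 'C(2 * k, k)%:R / k`!%:R ^+ 2.
Definition franel_w (k : nat) : rat := 1 / k`!%:R ^+ 3.

Lemma fact_neq0 (n : nat) : n`!%:R != 0 :> rat.
Proof. by rewrite pnatr_eq0 -lt0n fact_gt0. Qed.

Lemma bin_factE (n k : nat) : (k <= n)%N -> 'C(n, k)%:R = n`!%:R / (k`!%:R * (n - k)`!%:R) :> rat.
Proof.
move=> kn; apply: (canRL (mulfK _)); first by rewrite mulf_neq0 ?fact_neq0.
by rewrite -!natrM bin_fact.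
Qed.

Lemma Domb_self_conv (n : nat) : (Domb n)%:R = n`!%:R ^+ 2 * self_conv domb_w n.
Proof.
rewrite /Domb natr_sum mulr_sumr; apply: eq_big_nat => k /andP[_ kn].
rewrite -mulnBr 2!natrM natrX bin_factE // /domb_w.
have := fact_neq0 k; have := fact_neq0 (n - k); set x := _%:R; set y := _%:R.
by move=> x0 y0; field; rewrite x0 y0.
Qed.

Lemma franel_self_conv (n : nat) : (franel n)%:R = n`!%:R ^+ 3 * self_conv franel_w n.
Proof.
rewrite /franel natr_sum mulr_sumr; apply: eq_big_nat => k /andP[_ kn].
rewrite natrX bin_factE // /franel_w.
have := fact_neq0 k; have := fact_neq0 (n - k); set x := _%:R; set y := _%:R.
by move=> x0 y0; field; rewrite x0 y0.
Qed.

Lemma mul_bin_2diag (k : nat) : (k.+1 * 'C(2 * k.+1, k.+1) = 2 * (2 * k + 1) * 'C(2 * k, k))%N.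
Proof.
have := mul_bin_diag (2 * k).+2 k; have := mul_bin_down (2 * k).+1 k.
rewrite /= (_ : (2 * k).+1 - k = k.+1)%N; last lia.
rewrite (_ : (2 * k.+1 = (2 * k).+2)%N); last lia.
by move=> e1 <-; rewrite -mulnA addn1 e1; lia.
Qed.

Lemma domb_wS (k : nat) : (k%:R + 1) ^+ 3 * domb_w k.+1 = 2 * (2 * k%:R + 1) * domb_w k.
Proof.
rewrite /domb_w factS natrM.
have := congr1 (fun x : nat => x%:R : rat) (mul_bin_2diag k).
rewrite !natrM => e.
have k1 : k%:R + 1 != 0 :> rat by rewrite natr1 pnatr_eq0.
have f0 := fact_neq0 k.
move: e; rewrite natrD natrM -natr1; set A := 'C(_, _)%:R; set B := 'C(_, _)%:R.
move: k1 f0; set x := _%:R; set y := _%:R => k1 f0 e.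
transitivity ((x + 1) * A / y ^+ 2); first by field; rewrite k1 f0.
by rewrite e; field.
Qed.

Lemma franel_wS (k : nat) : (k%:R + 1) ^+ 3 * franel_w k.+1 = franel_w k.
Proof.
rewrite /franel_w factS natrM -natr1.
have k1 : k%:R + 1 != 0 :> rat by rewrite natr1 pnatr_eq0.
have f0 := fact_neq0 k.
by field; rewrite k1 f0.
Qed.

(** This is [domb_wS] read backwards. At [m = 0] the left side is padding and [m^3] vanishes, so no
    boundary case is left. *)
Lemma pad2_domb_w (m : nat) :
  pad2 domb_w m.+1 = m%:R ^+ 3 / (2 * (2 * m%:R - 1)) * pad2 domb_w m.+2.
Proof.
case: m => [|m] /=; first by rewrite expr0n /= !mul0r.
have h := @double_sub_odd_neq0 m.+1 1 isT.
apply: (mulfI h); rewrite -natr1; have e := domb_wS m.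
move: e; set x := m%:R; set A := domb_w _; set B := domb_w _ => e.
transitivity ((x + 1) ^+ 3 * A / 2); last by field; rewrite [1 + _]addrC natr1.
by rewrite e; field.
Qed.

Lemma pad2_franel_w (m : nat) : pad2 franel_w m.+1 = m%:R ^+ 3 * pad2 franel_w m.+2.
Proof.
by case: m => [|m] /=; rewrite ?expr0n ?mul0r // -natr1 franel_wS.
Qed.

(* Zeilberger certificates: with the summation index [k] and [m = n + 1 - k],
   the telescoping function is [k ^ 3 * domb_cert n k / (2 * m - 1)] (resp.
   [k ^ 3 * franel_cert n k]) times the summand [w k * w m]. *)
Definition domb_cert (n k : rat) : rat :=
  4 * k ^+ 3 - 12 * k ^+ 2 + 11 * k - 2 + n * (- 18 * k ^+ 2 + 37 * k - 16)
  + n ^+ 2 * (26 * k - 26) - 12 * n ^+ 3.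

Definition franel_cert (n k : rat) : rat :=
  4 * k ^+ 3 - 12 * k ^+ 2 + 12 * k - 4 + n * (- 18 * k ^+ 2 + 39 * k - 22)
  + n ^+ 2 * (27 * k - 32) - 14 * n ^+ 3.

(** The Domb recurrence divided by [x^2 n!^2]. *)
Lemma self_conv_domb_rec (n : nat) (x := n%:R + 1 : rat) :
  (x + 1) ^+ 5 * self_conv domb_w n.+2
  + - (2 * (2 * x + 1) * (5 * x ^+ 2 + 5 * x + 2)) * self_conv domb_w n.+1
  + 64 * x * self_conv domb_w n = 0.
Proof.
pose G k := k%:R ^+ 3 * domb_cert x k%:R / (2 * (x + 1 - k%:R) - 1) * domb_w k
            * pad2 domb_w (n.+4 - k).
apply: (@self_conv_rec _ G) => [k m e||].
- have ex : x = k%:R + m%:R - 1 by rewrite -natrD e -!natr1 /x; ring.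
  rewrite /G (_ : n.+4 - k.+1 = m.+1)%N; last lia.
  rewrite (_ : n.+4 - k = m.+2)%N; last lia.
  (* The cube of [k + 1] is absorbed by [domb_wS], which makes both values of [G] multiples of
     [domb_w k]. *)
  have -> : k.+1%:R ^+ 3 * domb_cert x k.+1%:R / (2 * (x + 1 - k.+1%:R) - 1)
       * domb_w k.+1
     = 2 * (2 * k%:R + 1) * domb_w k * (domb_cert x (k%:R + 1) / (2 * m%:R - 3)).
    rewrite -domb_wS -natr1 ex.
    have -> : 2 * (k%:R + m%:R - 1 + 1 - (k%:R + 1)) - 1 = 2 * m%:R - 3 :> rat by ring.
    by move: (domb_cert _ _) (domb_w _) => C A; ring.
  have -> : 2 * (x + 1 - k%:R) - 1 = 2 * m%:R - 1 by rewrite ex; ring.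
  have e1 := pad2_domb_w m.
  have e0 : pad2 domb_w m = (m%:R - 1) ^+ 3 / (2 * (2 * m%:R - 3)) * pad2 domb_w m.+1.
    case: (m) => [|m']; first by rewrite /= mulr0.
    rewrite pad2_domb_w -[m'.+1%:R]natr1.
    have -> : 2 * (m'%:R + 1) - 3 = 2 * m'%:R - 1 :> rat by ring.
    by rewrite addrK.
  (* Every term becomes a multiple of [domb_w k * pad2 domb_w m.+2]; a rational identity in [k] and
     [m] remains. *)
  rewrite e0 e1.
  have h1 := @double_sub_odd_neq0 m 1 isT; have h3 := @double_sub_odd_neq0 m 3 isT.
  rewrite ex /domb_cert; move: h1 h3; move: (pad2 _ _) (domb_w k) m%:R k%:R => A B y z h1 h3.
  by field; rewrite h1 h3.
- by rewrite /G expr0n /= !mul0r.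
- by rewrite /G (_ : n.+4 - n.+3 = 1)%N ?mulr0 //; lia.
Qed.

(** The Franel recurrence divided by [x^2 n!^3]. *)
Lemma self_conv_franel_rec (n : nat) (x := n%:R + 1 : rat) :
  x * (x + 1) ^+ 5 * self_conv franel_w n.+2
  + - (x * (7 * x ^+ 2 + 7 * x + 2)) * self_conv franel_w n.+1
  + - 8 * self_conv franel_w n = 0.
Proof.
pose G k := k%:R ^+ 3 * franel_cert x k%:R * franel_w k * pad2 franel_w (n.+4 - k).
apply: (@self_conv_rec _ G) => [k m e||].
- have ex : x = k%:R + m%:R - 1 by rewrite -natrD e -!natr1 /x; ring.
  rewrite /G (_ : n.+4 - k.+1 = m.+1)%N; last lia.
  rewrite (_ : n.+4 - k = m.+2)%N; last lia.
  have -> : k.+1%:R ^+ 3 * franel_cert x k.+1%:R * franel_w k.+1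
     = franel_w k * franel_cert x (k%:R + 1).
    by rewrite -[franel_w k]franel_wS -[k.+1%:R]natr1; move: (franel_cert _ _) (franel_w _) => C A; ring.
  have e1 := pad2_franel_w m.
  have e0 : pad2 franel_w m = (m%:R - 1) ^+ 3 * pad2 franel_w m.+1.
    case: (m) => [|m']; first by rewrite /= mulr0.
    by rewrite pad2_franel_w -[m'.+1%:R]natr1 addrK.
  rewrite e0 e1.
  rewrite ex /franel_cert; move: (pad2 _ _) (franel_w k) m%:R k%:R => A B y z.
  by ring.
- by rewrite /G expr0n /= !mul0r.
- by rewrite /G (_ : n.+4 - n.+3 = 1)%N ?mulr0 //; lia.
Qed.

Lemma Domb_rec (n : nat) (x := n%:R + 1 : rat) :
  (x + 1) ^+ 3 * (Domb n.+2)%:R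
  = 2 * (2 * x + 1) * (5 * x ^+ 2 + 5 * x + 2) * (Domb n.+1)%:R - 64 * x ^+ 3 * (Domb n)%:R.
Proof.
rewrite !Domb_self_conv !factS !natrM -!natr1 -/x.
apply/eqP; rewrite -subr_eq0; apply/eqP.
rewrite -(mulr0 (x ^+ 2 * n`!%:R ^+ 2)) -(self_conv_domb_rec n) -/x; ring.
Qed.

Lemma franel_rec (n : nat) (x := n%:R + 1 : rat) :
  (x + 1) ^+ 2 * (franel n.+2)%:R
  = (7 * x ^+ 2 + 7 * x + 2) * (franel n.+1)%:R + 8 * x ^+ 2 * (franel n)%:R.
Proof.
rewrite !franel_self_conv !factS !natrM -!natr1 -/x.
apply/eqP; rewrite -subr_eq0; apply/eqP.
rewrite -(mulr0 (x ^+ 2 * n`!%:R ^+ 3)) -(self_conv_franel_rec n) -/x; ring.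
Qed.

(** * Legendre coefficients and the Franel transform *)

(** Coefficient of [t^j] in the Legendre polynomial [P_n(1 + 2t)]. *)
Definition legendre_coef (n j : nat) : rat := 'C(n, j)%:R * 'C(n + j, j)%:R.

Lemma legendre_coef_small (n j : nat) : (n < j)%N -> legendre_coef n j = 0.
Proof. by move=> nj; rewrite /legendre_coef bin_small // mul0r. Qed.

(** Cleared of denominators so as to hold for every [j]: at [j = n + 1] the left factor and
    ['C(n, j)] both vanish. *)
Lemma legendre_coefSl (n j : nat) :
  (n%:R + 1 - j%:R) * legendre_coef n.+1 j = (n%:R + 1 + j%:R) * legendre_coef n j.
Proof.
rewrite /legendre_coef addSn.
have e1 : (n%:R + 1) * 'C(n, j)%:R = (n%:R + 1 - j%:R) * 'C(n.+1, j)%:R :> rat.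
  have [jn|jn] := leqP j n.+1; last by rewrite !bin_small ?mulr0 //; lia.
  by rewrite natr1 -natrB // -!natrM -mul_bin_down.
have e2 : (n%:R + 1 + j%:R) * 'C(n + j, j)%:R = (n%:R + 1) * 'C((n + j).+1, j)%:R :> rat.
  rewrite natr1 -natrD -!natrM addSn (mul_bin_down (n + j).+1) /=.
  by congr ((_ * _)%N%:R); lia.
have n0 : n%:R + 1 != 0 :> rat by rewrite natr1 pnatr_eq0.
apply: (mulfI n0).
transitivity (((n%:R + 1 - j%:R) * 'C(n.+1, j)%:R) * ((n%:R + 1) * 'C((n + j).+1, j)%:R) : rat).
  by ring.
by rewrite -e1 -e2; ring.
Qed.

Lemma legendre_coefSr (n j : nat) :
  (j%:R + 1) ^+ 2 * legendre_coef n j.+1 = (n%:R - j%:R) * (n%:R + j%:R + 1) * legendre_coef n j.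
Proof.
rewrite /legendre_coef addnS.
have e1 : (j%:R + 1) * 'C(n, j.+1)%:R = (n%:R - j%:R) * 'C(n, j)%:R :> rat.
  have [jn|jn] := leqP j n; last by rewrite !bin_small ?mulr0 //; lia.
  by rewrite natr1 -natrB // -!natrM mul_bin_left.
have e2 : (j%:R + 1) * 'C((n + j).+1, j.+1)%:R = (n%:R + j%:R + 1) * 'C(n + j, j)%:R :> rat.
  by rewrite -natrD !natr1 -!natrM -mul_bin_diag.
transitivity (((j%:R + 1) * 'C(n, j.+1)%:R) * ((j%:R + 1) * 'C((n + j).+1, j.+1)%:R) : rat).
  by ring.
by rewrite e1 e2; ring.
Qed.

Lemma legendre_coefSS (n j : nat) :
  (j%:R + 1) ^+ 2 * legendre_coef n.+1 j.+1 = (n%:R + j%:R + 1) * (n%:R + j%:R + 2) * legendre_coef n j.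
Proof.
have -> : (j%:R + 1) ^+ 2 * legendre_coef n.+1 j.+1
   = (n%:R + j%:R + 2) * ((n%:R + 1 - j%:R) * legendre_coef n.+1 j).
  by rewrite legendre_coefSr -[n.+1%:R]natr1; ring.
by rewrite legendre_coefSl; ring.
Qed.

(** The weight of [f_j] in the formula for Domb(n), with [8^(n-j)] split to avoid truncated
    subtraction when [j > n]. *)
Definition kern (n j : nat) : rat := 8 ^+ n * (- 8^-1) ^+ j * legendre_coef n j.

(** For [j > 0] this is [legendre_coefSS]; the factor [y ^+ 2] kills the truncated index [j.-1] at
    [j = 0]. *)
Lemma kern_pred (n j : nat) (x := n%:R + 1 : rat) (y := j%:R : rat) :
  y ^+ 2 * kern n.+1 j.-1 = - y ^+ 4 / ((x + y + 1) * (x + y)) * kern n.+2 j.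
Proof.
have x0 : 0 < x by rewrite /x natr1 ltr0n.
rewrite {}/y; case: j => [|j] /=; first by rewrite !expr0n /= oppr0 !mul0r.
rewrite -[j.+1%:R]natr1; have j0 : 0 <= j%:R :> rat by rewrite ler0n.
have := legendre_coefSS n.+1 j; rewrite -[n.+1%:R]natr1 -/x => e3.
transitivity (- (j%:R + 1) ^+ 2 / ((x + (j%:R + 1) + 1) * (x + (j%:R + 1)))
   * (8 ^+ n.+2 * (- 8^-1) ^+ j.+1 * ((j%:R + 1) ^+ 2 * legendre_coef n.+2 j.+1)));
  last by rewrite /kern; ring.
rewrite e3 /kern [_ ^+ j.+1]exprS [8 ^+ n.+2]exprS; field.
by rewrite !lt0r_neq0 //; lra.
Qed.

(* The bracket on the right is the adjoint of the Franel recurrence operator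
   applied to [kern n.+1], so it vanishes when summed against [franel]. *)
Lemma kern_rec (n j : nat) (x := n%:R + 1 : rat) (y := j%:R : rat) :
  (x + 1) ^+ 3 * kern n.+2 j
  - 2 * (2 * x + 1) * (5 * x ^+ 2 + 5 * x + 2) * kern n.+1 j
  + 64 * x ^+ 3 * kern n j
  = - 2 * (2 * x + 1) * (y ^+ 2 * kern n.+1 j.-1 - (7 * y ^+ 2 + 7 * y + 2) * kern n.+1 j
      - 8 * (y + 1) ^+ 2 * kern n.+1 j.+1).
Proof.
have e : (y + 1) ^+ 2 * kern n.+1 j.+1
  = - 8^-1 * (x - y) * (x + y + 1) * kern n.+1 j.
  transitivity (8 ^+ n.+1 * (- 8^-1) ^+ j.+1 * ((y + 1) ^+ 2 * legendre_coef n.+1 j.+1)).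
    by rewrite /kern; ring.
  by rewrite legendre_coefSr -[n.+1%:R]natr1 -/x -/y /kern [_ ^+ j.+1]exprS; ring.
have x0 : 0 < x by rewrite /x natr1 ltr0n.
have y0 : 0 <= y by rewrite ler0n.
have xy1 : x + y + 1 != 0 by apply: lt0r_neq0; lra.
have xy : x + y != 0 by apply: lt0r_neq0; lra.
(* All values are expressed through [kern n.+2 j]: in this direction the denominators [x + y + 1]
   and [x + y] are positive, while the opposite ratios would divide by [x + 1 - y] and [x - y]. *)
have e1 : kern n.+1 j = 8^-1 * (x + 1 - y) / (x + y + 1) * kern n.+2 j.
  apply: (mulfI xy1); rewrite /kern.
  transitivity (8 ^+ n.+1 * (- 8^-1) ^+ j * ((n.+1%:R + 1 + j%:R) * legendre_coef n.+1 j)).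
    by rewrite -[n.+1%:R]natr1 -/x -/y; ring.
  by rewrite -legendre_coefSl -[n.+1%:R]natr1 -/x -/y !exprS; field.
have e2 : kern n j = 8^-1 * (x - y) / (x + y) * kern n.+1 j.
  apply: (mulfI xy); rewrite /kern.
  transitivity (8 ^+ n * (- 8^-1) ^+ j * ((n%:R + 1 + j%:R) * legendre_coef n j)).
    by rewrite -/x -/y; ring.
  by rewrite -legendre_coefSl -/x -/y !exprS; field.
have e3 := kern_pred n j; rewrite -/x -/y in e3.
rewrite e3 -(mulrA 8) e e2 e1; move: (kern _ _) => K; clear e e1 e2 e3 x0 y0.
move: xy xy1; clearbody x y => xy xy1; field.
by rewrite xy xy1.
Qed.

Definition franel_transform (n : nat) : rat :=
  \sum_(0 <= j < n.+1) kern n j * (franel j)%:R.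

Lemma franel_transform_widen (n N : nat) : (n < N)%N ->
  franel_transform n = \sum_(0 <= j < N) kern n j * (franel j)%:R.
Proof.
move=> nN; rewrite [RHS](big_cat_nat (n := n.+1)) //= [X in _ + X]big_nat_cond.
rewrite [X in _ + X]big1 ?addr0 //.
by move=> j /andP[/andP[nj _] _]; rewrite /kern legendre_coef_small // mulr0 mul0r.
Qed.

Lemma franel_transform_rec (n : nat) (x := n%:R + 1 : rat) :
  (x + 1) ^+ 3 * franel_transform n.+2
  = 2 * (2 * x + 1) * (5 * x ^+ 2 + 5 * x + 2) * franel_transform n.+1
    - 64 * x ^+ 3 * franel_transform n.
Proof.
rewrite !(@franel_transform_widen _ n.+3) //; try lia.
apply/eqP; rewrite -subr_eq0; apply/eqP.
rewrite opprB addrA !mulr_sumr -big_split -sumrB /=.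
(* Boundary term of the summation by parts that moves the Franel operator from [kern] to [franel].
   It vanishes at [j = 0] through [j^2], and at [j = n + 3] because [kern n.+1] is zero beyond
   [n + 1]. *)
pose Z j : rat := 2 * (2 * x + 1) * (j%:R ^+ 2 * (kern n.+1 j.-1 * (franel j)%:R
                    + 8 * kern n.+1 j * (franel j.-1)%:R)).
rewrite (@eq_big_nat _ _ _ _ _ _ (fun j => Z j.+1 - Z j)).
  have Z0 : Z 0%N = 0 by rewrite /Z expr0n /= mul0r mulr0.
  by rewrite telescope_sumr // Z0 subr0 /Z /kern !legendre_coef_small //= !(mulr0, mul0r, addr0).
move=> j _.
transitivity ((franel j)%:R * ((x + 1) ^+ 3 * kern n.+2 j
  - 2 * (2 * x + 1) * (5 * x ^+ 2 + 5 * x + 2) * kern n.+1 j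
  + 64 * x ^+ 3 * kern n j)).
  by move: (kern _ _) (kern _ _) (kern _ _) (franel j)%:R => K2 K1 K0 c; ring.
rewrite kern_rec -/x.
(* The Franel recurrence also covers [j = 0], where [j^2] removes the term with [j.-1]. *)
have e : (j%:R + 1) ^+ 2 * (franel j.+1)%:R = (7 * j%:R ^+ 2 + 7 * j%:R + 2) * (franel j)%:R
   + 8 * j%:R ^+ 2 * (franel j.-1)%:R :> rat.
  case: j => [|j]; last by rewrite -[j.+1%:R]natr1 franel_rec.
  by rewrite /franel !big_nat_recr //= !big_nil; ring.
rewrite /Z /= -[j.+1%:R]natr1.
move: e; set a := (franel j.+1)%:R; set p := 7 * _ + _ + _; set c := (franel j)%:R.
set d := (franel _)%:R => e.
transitivity (2 * (2 * x + 1) * (kern n.+1 j * (p * c + 8 * j%:R ^+ 2 * d)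
   + 8 * (j%:R + 1) ^+ 2 * kern n.+1 j.+1 * c
   - j%:R ^+ 2 * kern n.+1 j.-1 * c - 8 * j%:R ^+ 2 * kern n.+1 j * d)).
  by clearbody p c d; move: (kern _ _) (kern _ _) (kern _ _) => K2 K1 K0; ring.
by rewrite -e; ring.
Qed.

Lemma Domb_franel_transform (n : nat) : (Domb n)%:R = franel_transform n.
Proof.
(* The common recurrence has order two, so the induction carries two consecutive values. *)
suff : (Domb n)%:R = franel_transform n /\ (Domb n.+1)%:R = franel_transform n.+1 by case.
elim: n => [|n [IH1 IH2]].
  by rewrite /Domb /franel_transform /kern /legendre_coef /franel !big_nat_recr //= !big_nil.
split=> //.
have h : (n%:R + 1 + 1) ^+ 3 != 0 :> rat by rewrite expf_neq0 // !natr1 pnatr_eq0.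
apply: (mulfI h); apply: etrans (Domb_rec n) _.
by rewrite IH1 IH2; symmetry; apply: franel_transform_rec.
Qed.

(** * Positivity of the two sums *)

Lemma horner_sumS {R : comPzRingType} (a : nat -> R) (x : R) (n : nat) :
  \sum_(0 <= k < n.+2) a k * x ^+ (n.+1 - k)
  = x * \sum_(0 <= k < n.+1) a k * x ^+ (n - k) + a n.+1.
Proof.
rewrite big_nat_recr //= subnn expr0 mulr1 mulr_sumr; congr (_ + _).
by apply: eq_big_nat => k /andP[_ kn]; rewrite subSn // exprS mulrCA.
Qed.

Lemma Domb_gt0 (n : nat) : (0 < Domb n)%N.
Proof. by rewrite /Domb big_nat_recl // bin0 !muln0 !subn0 !mul1n addn_gt0 bin_gt0 leq_pmull. Qed.

Lemma Domb_growth (n : nat) :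
  8 * (2 * n%:R + 1) * (Domb n)%:R < (2 * n%:R + 3) * (Domb n.+1)%:R :> rat.
Proof.
elim: n => [|n IH]; first by rewrite /Domb !big_nat_recr //= !big_nil !mulr0.
have := Domb_rec n; rewrite -[n.+1%:R]natr1.
have : 0 < (Domb n.+1)%:R :> rat by rewrite ltr0n Domb_gt0.
have : 0 <= n%:R :> rat by rewrite ler0n.
move: IH; move: n%:R (Domb n)%:R (Domb n.+1)%:R (Domb n.+2)%:R => t a b c IH t0 b0 e.
rewrite -subr_gt0 in IH; rewrite -subr_gt0.
(* This factor clears the leading coefficient of the recurrence and allows [a] to be eliminated
   through the induction hypothesis; what remains is [b] times a polynomial with positive
   coefficients. *)
have d0 : 0 < (2 * t + 1) * (t + 2) ^+ 3.
  by rewrite mulr_gt0 ?exprn_gt0 //; lra.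
rewrite -(pmulr_rgt0 _ d0).
have -> : (2 * t + 1) * (t + 2) ^+ 3 * ((2 * (t + 1) + 3) * c - 8 * (2 * (t + 1) + 1) * b)
  = 8 * (t + 1) ^+ 3 * (2 * t + 5) * ((2 * t + 3) * b - 8 * (2 * t + 1) * a)
    + 2 * (2 * t + 3) * (4 * t ^+ 4 + 24 * t ^+ 3 + 49 * t ^+ 2 + 39 * t + 8) * b.
  transitivity ((2 * t + 1) * ((2 * (t + 1) + 3) * ((t + 1 + 1) ^+ 3 * c)
    - (t + 2) ^+ 3 * (8 * (2 * (t + 1) + 1) * b))); first by ring.
  by rewrite e; ring.
rewrite addr_gt0 //; first by rewrite !mulr_gt0 ?exprn_gt0 //; lra.
rewrite mulr_gt0 // mulr_gt0 //; first lra.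
have := exprn_ge0 4 t0; have := exprn_ge0 3 t0; have := exprn_ge0 2 t0; lra.
Qed.

Definition domb_sum (x : rat) (n : nat) : rat :=
  \sum_(0 <= k < n.+1) (2 * k + 1)%N%:R * (Domb k)%:R * x ^+ (n - k)%N.

Lemma domb_sum_gt0 (n : nat) : 0 < domb_sum 8 n.
Proof.
rewrite /domb_sum big_nat_recr //= subnn expr0 mulr1 ltr_wpDl //.
  by apply: sumr_ge0 => k _; rewrite !mulr_ge0 ?exprn_ge0.
by rewrite -natrM ltr0n muln_gt0 Domb_gt0 addn1.
Qed.

(** A Horner step sends [u] to [(2n+3) Domb(n+1) - 8u]: the upper bound on [u] and [Domb_growth]
    give positivity, and [u > 0] gives the next upper bound. *)
Lemma domb_sumN_bounds (n : nat) : 0 < domb_sum (- 8) n <= (2 * n%:R + 1) * (Domb n)%:R.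
Proof.
elim: n => [|n /andP[IH1 IH2]].
  by rewrite /domb_sum big_nat1 /Domb big_nat1.
rewrite /domb_sum (horner_sumS (fun k => (2 * k + 1)%N%:R * (Domb k)%:R)) -/(domb_sum (- 8) n).
have := Domb_growth n; rewrite natrD natrM -[n.+1%:R]natr1.
move: IH1 IH2; move: (domb_sum _ _) (Domb n)%:R (Domb n.+1)%:R n%:R => u a b t h1 h2 h3.
have -> : (2 * (t + 1) + 1) * b = (2 * t + 3) * b by ring.
by apply/andP; split; lra.
Qed.

(** * Integrality of the two quotients *)

(** The [8^k] in [kern k j] and the [8^(n-k)] of the sum merge into [8^n], so the inner sum over [k]
    keeps only [eps]. *)
Lemma domb_sum_legendre_coef (eps : rat) (n : nat) : domb_sum (8 * eps) n =
  \sum_(0 <= j < n.+1) 8 ^+ n * (- 8^-1) ^+ j * (franel j)%:R *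
     \sum_(0 <= k < n.+1) (2 * k%:R + 1) * legendre_coef k j * eps ^+ (n - k).
Proof.
under [RHS]eq_bigr do rewrite mulr_sumr.
rewrite exchange_big; apply: eq_big_nat => k /andP[_ kn].
rewrite Domb_franel_transform (@franel_transform_widen k n.+1) // mulr_sumr mulr_suml.
apply: eq_bigr => j _; rewrite /kern exprMn natrD natrM.
rewrite -[in RHS](subnKC (_ : k <= n)%N) ?exprD; last lia.
rewrite addKn; ring.
Qed.

Lemma sum_legendre_coef (n j : nat) :
  \sum_(0 <= k < n.+1) (2 * k%:R + 1) * legendre_coef k j * 1 ^+ (n - k)
  = n.+1%:R * ('C(n.+1, j.+1)%:R * 'C(n.+1 + j, j)%:R) :> rat.
Proof.
have j0 : j%:R + 1 != 0 :> rat by rewrite natr1 pnatr_eq0.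
apply: (mulfI j0).
(* In terms of [legendre_coef n j], the closed form advances from [n] to [n + 1] by
   [legendre_coefSl] alone. *)
have -> : (j%:R + 1) * (n.+1%:R * ('C(n.+1, j.+1)%:R * 'C(n.+1 + j, j)%:R))
  = (n%:R + 1) * ((n%:R + 1 + j%:R) * legendre_coef n j).
  have e : (j%:R + 1) * 'C(n.+1, j.+1)%:R = (n%:R + 1 - j%:R) * 'C(n.+1, j)%:R :> rat.
    have [jn|jn] := leqP j n.+1; last by rewrite !bin_small ?mulr0 //; lia.
    by rewrite !natr1 -natrB // -!natrM mul_bin_left.
  rewrite -legendre_coefSl /legendre_coef [(n%:R + 1 - _) * _]mulrA -e -[n.+1%:R]natr1; ring.
elim: n => [|n IH].
  by rewrite big_nat1 /=; case: j {j0} => [|j]; rewrite /legendre_coef ?bin0 ?bin0n /=; ring.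
rewrite (horner_sumS (fun k => (2 * k%:R + 1) * legendre_coef k j)) mul1r mulrDr IH.
rewrite -legendre_coefSl -[n.+1%:R]natr1; ring.
Qed.

Lemma alt_sum_legendre_coef (n j : nat) :
  \sum_(0 <= k < n.+1) (2 * k%:R + 1) * legendre_coef k j * (- 1) ^+ (n - k)
  = n.+1%:R * ('C(n, j)%:R * 'C(n.+1 + j, j)%:R) :> rat.
Proof.
(* Again a multiple of [legendre_coef n j], to which [legendre_coefSl] applies in the induction. *)
have -> : n.+1%:R * ('C(n, j)%:R * 'C(n.+1 + j, j)%:R) = (n%:R + 1 + j%:R) * legendre_coef n j.
  rewrite /legendre_coef mulrCA [RHS]mulrCA natr1; congr (_ * _).
  rewrite -natrD -!natrM (mul_bin_down (n.+1 + j)) /=.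
  by congr ((_ * _)%N%:R); lia.
elim: n => [|n IH].
  by rewrite big_nat1 /=; case: j => [|j]; rewrite /legendre_coef ?bin0 ?bin0n /=; ring.
rewrite (horner_sumS (fun k => (2 * k%:R + 1) * legendre_coef k j)) IH -legendre_coefSl -[n.+1%:R]natr1; ring.
Qed.

Lemma domb_sum_int (eps : rat) (P : nat -> nat) (n : nat) :
  (forall j, \sum_(0 <= k < n.+1) (2 * k%:R + 1) * legendre_coef k j * eps ^+ (n - k)
     = n.+1%:R * (P j)%:R) ->
  1 / n.+1%:R * domb_sum (8 * eps) n \is a Num.int.
Proof.
move=> H; rewrite domb_sum_legendre_coef mulr_sumr big_nat_cond rpred_sum // => j /andP[/andP[_ jn] _].
(* Since [j <= n], the power [8 ^+ j] cancels the denominators of [(- 8^-1) ^+ j]. *)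
have -> : 8 ^+ n = 8 ^+ (n - j) * 8 ^+ j :> rat by rewrite -exprD subnK.
rewrite H.
have n0 : n.+1%:R != 0 :> rat by rewrite pnatr_eq0.
have -> : 1 / n.+1%:R * (8 ^+ (n - j) * 8 ^+ j * (- 8^-1) ^+ j * (franel j)%:R
            * (n.+1%:R * (P j)%:R))
  = 8 ^+ (n - j) * (- 1) ^+ j * (franel j)%:R * (P j)%:R :> rat.
  have e : 8 ^+ j * (- 8^-1) ^+ j = (- 1) ^+ j :> rat by rewrite -exprMn; congr (_ ^+ _).
  by rewrite -e; field; rewrite addrC natr1.
by rewrite !rpredM ?rpredX ?rpredN ?rpred1 ?natr_int.
Qed.

Theorem theorem1p3 (n : nat) (hn : (0 < n)%N) :
  let S (x : rat) : rat :=
    1 / n%:R *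
      \sum_(0 <= k < n) (2 * k + 1)%N%:R * (Domb k)%:R * x ^+ (n - 1 - k)%N in
  (S 8 \is a Num.int /\ 0 < S 8) /\ (S (- 8) \is a Num.int /\ 0 < S (- 8)).
Proof.
case: n hn => [//|n] _ S.
have SE x : S x = 1 / n.+1%:R * domb_sum x n by rewrite /S subn1.
have n0 : 0 < 1 / n.+1%:R :> rat by rewrite div1r invr_gt0 ltr0n.
rewrite !SE !(pmulr_rgt0 _ n0) domb_sum_gt0; have /andP[-> _] := domb_sumN_bounds n.
split; split=> //.
- rewrite -[8]mulr1; apply: (@domb_sum_int 1 (fun j => 'C(n.+1, j.+1) * 'C(n.+1 + j, j))%N) => j.
  by rewrite sum_legendre_coef natrM.
- rewrite -mulrN1; apply: (@domb_sum_int (- 1) (fun j => 'C(n, j) * 'C(n.+1 + j, j))%N) => j.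
  by rewrite alt_sum_legendre_coef natrM.
Qed.
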